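(* Let $k\le l$ be positive integers with $\gcd(k,l)=1$, let $n\ge 1$ and $m\ge 0$ be integers, and write $m=qn+r$ with integers $q\ge 0$ and $0\le r<n$. Let $S$ be the minimum of $x+y$ over all integers $x,y$ satisfying $$qxy+r(xl+yk)\ge klnr,\qquad x\ge rk,\qquad y\ge rl.$$ Then $$L^{k,l}(m,n)=nkq+\min(nk,\,S).$$
   Context: $\mathcal D^{k,l}(m,n)$ denotes the set of all $nk\times nl$ matrices with nonnegative integer entries all of whose row sums equal $ml$ and all of whose column sums equal $mk$. For an $s\times t$ matrix $A=(a_{ij})$ with $s\le t$, a transversal of $A$ is a set of entries $T=\{a_{1i_1},\dots,a_{si_s}\}$ taken from distinct columns (i.e. $i_1,\dots,i_s\in\{1,\dots,t\}$ pairwise distinct), and $|T|=a_{1i_1}+\cdots+a_{si_s}$; if $s>t$, the transversals of $A$ are defined to be those of its transpose. The tropical determinant is ${\rm tdet}(A)=\max_T |T|$ over all transversals $T$ of $A$. Finally $L^{k,l}(m,n)=\min_{A\in\mathcal D^{k,l}(m,n)}{\rm tdet}(A)$. *)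

(* Defs.v *)
From mathcomp Require Import all_boot all_order all_algebra.
From mathcomp Require Import zify.
Set Implicit Arguments. Unset Strict Implicit. Unset Printing Implicit Defensive.

Definition inD (k l m n : nat) (A : 'M[nat]_(n * k, n * l)) : Prop :=
  (forall i, \sum_(j < n * l) A i j = m * l) /\
  (forall j, \sum_(i < n * k) A i j = m * k).

Arguments inD : clear implicits.

Definition tdet_rows (s t : nat) (A : 'M[nat]_(s, t)) : nat :=
  \max_(f : {ffun 'I_s -> 'I_t} | injectiveb f) \sum_(i < s) A i (f i).

Definition tdet (s t : nat) (A : 'M[nat]_(s, t)) : nat :=
  if s <= t then tdet_rows A else tdet_rows A^T.

Definition Sfeas (k l n q r x y : nat) : bool :=
  [&& q * x * y + r * (x * l + y * k) >= k * l * n * r, x >= r * k & y >= r * l].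

Definition Spred (k l n q r : nat) : pred nat := fun s =>
  [exists x : 'I_s.+1, exists y : 'I_s.+1,
      (x + y == s) && Sfeas k l n q r x y].

Lemma Spred_ex (k l n q r : nat) : 0 < l -> exists s, Spred k l n q r s.
Proof.
move=> l0.
exists (k * l * n + r * k + r * l).
apply/existsP; exists (inord (k * l * n + r * k)).
apply/existsP; exists (inord (r * l)).
rewrite !inordK; try lia.
apply/andP; split; first by [].
rewrite /Sfeas; apply/and3P; split; nia.
Qed.

(* S = min of x + y over feasible integer pairs (0 if l = 0, never used) *)
Definition Smin (k l n q r : nat) : nat :=
  match (0 < l) =P true with
  | ReflectT h => ex_minn (Spred_ex k n q r h)
  | ReflectF _ => 0
  end.

(* Main.v *)
Require Import Defs.
From mathcomp Require Import all_boot all_order all_algebra.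
From mathcomp Require Import zify.
Set Implicit Arguments. Unset Strict Implicit. Unset Printing Implicit Defensive.

(** Lower bound.  By Egervary duality there are natural [u] and [v] with
    [A i j <= u i + v j] and total at most [tdet A].  Shift [v] so that it vanishes
    somewhere.  If the total is below [nkq + nk], then comparing the row and column sums
    of [A] with the cover forces [min u = q], and counting the entries in the rows with
    [u i = q] shows that [(sum (u - q), sum v)] is feasible for [S].

    Upper bound.  For an optimal feasible [(x, y)] with [x + y < nk], a matrix in
    [D^{k,l}(m,n)] covered by [u i = q + (i < x)], [v j = (j < y)] is built: the lower
    right block is constant [q], the off-diagonal blocks have entries [q] and [q + 1],
    and the [x * y] corner has the sum left over, [q x y + r (x l + y k) - k l n r],
    spread evenly, which keeps its entries at most [q + 2].  If [nk <= x + y], a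
    circulant matrix with entries [q] and [q + 1] is enough. *)

(** * Hall's marriage theorem and Egervary duality *)

Definition nbhd (T U : finType) (E : T -> U -> bool) (I : {set T}) : {set U} :=
  [set y | [exists x in I, E x y]].

Lemma nbhdP (T U : finType) (E : T -> U -> bool) (I : {set T}) y :
  reflect (exists2 x, x \in I & E x y) (y \in nbhd E I).
Proof. by rewrite inE; apply: (iffP exists_inP). Qed.

(** Induction on [#|A|]. A nonempty proper subset with no spare neighbour is matched separately from
    its complement; if there is none, any one edge can be fixed and its endpoints deleted. [u0] only
    supplies values off [A]. *)
Lemma hall (T U : finType) (u0 : U) (E : T -> U -> bool) (A : {set T}) :
  (forall I : {set T}, I \subset A -> #|I| <= #|nbhd E I|) ->
  exists2 f : T -> U, {in A &, injective f} & {in A, forall x, E x (f x)}.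
Proof.
have [c] := ubnP #|A|; elim: c E A => // c IH E A ltAc hallA.
have [-> | [x0 x0A]] := set_0Vmem A.
  by exists (fun=> u0) => [x y|x]; rewrite inE.
have [/existsP[I /and4P[I0 sIA nIA tI]]|notight] := boolP [exists I : {set T},
    [&& I != set0, I \subset A, I != A & #|nbhd E I| <= #|I|]].
  have ltI : #|I| < #|A| by apply: proper_card; rewrite properEneq nIA.
  have [f1 f1inj f1E] : exists2 f : T -> U,
      {in I &, injective f} & {in I, forall x, E x (f x)}.
    apply: IH; first lia.
    by move=> J sJI; apply: hallA; apply: subset_trans sIA.
  pose E' x y := E x y && (y \notin nbhd E I).
  have [f2 f2inj f2E] : exists2 f : T -> U,
      {in A :\: I &, injective f} & {in A :\: I, forall x, E' x (f x)}.
    apply: IH.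
      have := cardsID I A; rewrite (setIidPr sIA).
      by move: I0; rewrite -card_gt0; lia.
    move=> J sJ.
    have dJI : [disjoint J & I].
      by apply/setDidPl; apply/setP => x; rewrite !inE andbC;
         case: (boolP (x \in J)) => //= /(subsetP sJ); rewrite inE => /andP[].
    have sub : nbhd E (J :|: I) \subset nbhd E' J :|: nbhd E I.
      apply/subsetP => y /nbhdP[x]; rewrite in_setU => /orP[xJ|xI] Exy.
        rewrite in_setU; case: (boolP (y \in nbhd E I)) => [yI|yI]; first by rewrite orbT.
        by apply/orP; left; apply/nbhdP; exists x => //; rewrite /E' Exy.
      by rewrite in_setU; apply/orP; right; apply/nbhdP; exists x.
    have := subset_leq_card sub.
    have : #|J :|: I| <= #|nbhd E (J :|: I)|.
      apply: hallA; rewrite subUset sIA andbT.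
      exact: subset_trans sJ (subsetDl _ _).
    rewrite !cardsU.
    have -> : J :&: I = set0 by apply/setP=> x; rewrite in_set0;
      have := disjoint_setI0 dJI => ->; rewrite in_set0.
    by rewrite cards0; lia.
  exists (fun x => if x \in I then f1 x else f2 x).
    have mem2 x : x \in A -> x \notin I -> x \in A :\: I by rewrite inE => -> ->.
    have cross x y : x \in I -> y \in A -> y \notin I -> f1 x <> f2 y.
      move=> xI yA yI eqf; have := f2E _ (mem2 _ yA yI).
      rewrite /E' -eqf => /andP[_ /negP]; apply.
      by apply/nbhdP; exists x => //; apply: f1E.
    move=> x y xA yA.
    case: (boolP (x \in I)) => xI; case: (boolP (y \in I)) => yI.
    - exact: f1inj.
    - by move=> e; case: (cross x y).
    - by move=> e; case: (cross y x).
    - by apply: f2inj; apply: mem2.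
  move=> x xA; case: (boolP (x \in I)) => xI; first exact: f1E.
  have xD : x \in A :\: I by rewrite inE xI.
  by have /andP[] := f2E _ xD.
have [y0 y0N] : exists y0, y0 \in nbhd E [set x0].
  apply/set0Pn; rewrite -card_gt0.
  by have := hallA [set x0]; rewrite sub1set x0A cards1; apply.
have Exy0 : E x0 y0 by have /nbhdP[x /set1P->] := y0N.
pose E' x y := E x y && (y != y0).
have [f finj fE] : exists2 f : T -> U,
    {in A :\ x0 &, injective f} & {in A :\ x0, forall x, E' x (f x)}.
  apply: IH; first by rewrite (cardsD1 x0 A) x0A in ltAc; lia.
  move=> J sJ; have [->|J0] := eqVneq J set0; first by rewrite cards0.
  have sJA : J \subset A by apply: subset_trans sJ (subD1set _ _).
  have nJA : J != A.
    by apply: contraTneq sJ => ->; apply/negP => /subsetP/(_ _ x0A); rewrite !inE eqxx.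
  (* Without a tight subset there is a neighbour to spare, so losing [y0] is harmless. *)
  have ltJ : #|J| < #|nbhd E J|.
    rewrite ltnNge; apply: contra notight => le.
    by apply/existsP; exists J; rewrite J0 sJA nJA.
  have sub : nbhd E J \subset y0 |: nbhd E' J.
    apply/subsetP => y /nbhdP[x xJ Exy]; rewrite in_setU1.
    case: (eqVneq y y0) => //= ny; apply/nbhdP; exists x => //.
    by rewrite /E' Exy.
  have := subset_leq_card sub; rewrite cardsU1; lia.
exists (fun x => if x == x0 then y0 else f x).
  have mem2 x : x \in A -> x != x0 -> x \in A :\ x0 by rewrite !inE => -> ->.
  have cross x : x \in A -> x != x0 -> f x <> y0.
    by move=> xA nx e; have /andP[_] := fE _ (mem2 _ xA nx); rewrite e eqxx.
  move=> x y xA yA.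
  case: (eqVneq x x0) => [->|nx]; case: (eqVneq y x0) => [->|ny] //.
  - by move=> /esym/cross; case.
  - by move=> /cross; case.
  - by apply: finj; apply: mem2.
move=> x xA; case: (eqVneq x x0) => [->|nx] //.
have xD : x \in A :\ x0 by rewrite !inE nx.
by have /andP[] := fE _ xD.
Qed.

(* Hungarian method: a Hall violator [J] of the tight graph lowers the cost of the
   cover.  If [u] vanishes somewhere on [J], then [v] is positive off the
   neighbourhood of [J], so the step can be shifted to keep [u] and [v] natural. *)
Lemma egervary_square (N : nat) (a : 'I_N -> 'I_N -> nat) :
  exists u v : 'I_N -> nat, (forall i j, a i j <= u i + v j) /\
  exists2 f : 'I_N -> 'I_N, injective f &
    \sum_i u i + \sum_j v j = \sum_i a i (f i).
Proof.
case: N a => [|N] a.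
  exists (fun=> 0), (fun=> 0); split; first by case.
  by exists id => //; rewrite !big_ord0.
(* Descent on the total cost, bounded by [c], starting from the row sums as [u] and zero as [v]. *)
suff step c (u v : 'I_N.+1 -> nat) : (forall i j, a i j <= u i + v j) ->
    \sum_(i < N.+1) u i + \sum_(j < N.+1) v j < c ->
    exists u v : 'I_N.+1 -> nat, (forall i j, a i j <= u i + v j) /\
    exists2 f : 'I_N.+1 -> 'I_N.+1, injective f &
      \sum_i u i + \sum_j v j = \sum_i a i (f i).
  apply: (step _ (fun i => \sum_j a i j) (fun=> 0)) (ltnSn _) => i j.
  by rewrite addn0 (bigD1 j) //= leq_addr.
elim: c u v => // c IH u v cov ltc.
pose E i j := a i j == u i + v j.
have [/forallP hallE|/forallPn[I]] :=
    boolP [forall I : {set 'I_N.+1}, #|I| <= #|nbhd E I|].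
  have [f finj fE] := @hall _ _ ord0 E setT (fun I _ => hallE I).
  have injf : injective f by move=> i j; apply: finj.
  exists u, v; split => //; exists f => //.
  rewrite (reindex_inj injf (F := v)) -big_split /=.
  by apply: eq_bigr => i _; apply/esym/eqP/fE.
rewrite -ltnNge => ltI0.
have [{ltI0} J [M [ltI loose]]] : exists J M : {set 'I_N.+1},
    #|M| < #|J| /\ forall i j, i \in J -> j \notin M -> a i j < u i + v j.
  exists I, (nbhd E I); split=> // i j iI jM.
  rewrite ltn_neqAle cov andbT; apply: contra jM => Eij.
  by apply/nbhdP; exists i.
have sumI (X : {set 'I_N.+1}) : \sum_i ((i \in X) : nat) = #|X|.
  by rewrite -sum1_card [RHS]big_mkcond; apply: eq_bigr => i _; case: (i \in X).
have [/exists_inP[i0 i0I /eqP ui0]|/exists_inPn uI] :=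
    boolP [exists i in J, u i == 0].
  have v_gt0 j : j \notin M -> 0 < v j.
    by move=> jM; have := loose i0 j i0I jM; rewrite ui0; lia.
  apply: (IH (fun i => u i + (i \in ~: J)) (fun j => v j - (j \in ~: M))).
    move=> i j; rewrite !in_setC; have := cov i j; have := loose i j; have := v_gt0 j.
    by case: (i \in J); case: (j \in M) => //= h1 h2 h3;
      try have := h1 isT; try have := h2 isT isT; lia.
  have vE : \sum_j v j = \sum_j (v j - (j \in ~: M)) + #|~: M|.
    rewrite -sumI -big_split /=; apply: eq_bigr => j _.
    by rewrite in_setC; have := v_gt0 j; case: (j \in M) => //= [|/(_ isT)]; lia.
  apply: leq_trans (ltnSE ltc).
  rewrite vE big_split /= sumI -addnA ltn_add2l addnC ltn_add2l.
  have := cardsC J; have := cardsC M; move: ltI.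
  by move: #|_| #|_| #|_| #|_| => *; lia.
apply: (IH (fun i => u i - (i \in J)) (fun j => v j + (j \in M))).
  move=> i j; have := cov i j; have := loose i j; have := uI i.
  case: (i \in J); case: (j \in M) => //= h1 h2 h3;
      try have := h1 isT; try have := h2 isT isT; lia.
have uE : \sum_i u i = \sum_i (u i - (i \in J)) + #|J|.
  rewrite -sumI -big_split /=; apply: eq_bigr => i _.
  by have := uI i; case: (i \in J) => //= [/(_ isT)|]; lia.
apply: leq_trans (ltnSE ltc).
by rewrite uE big_split /= sumI -addnA ltn_add2l addnC ltn_add2r.
Qed.

(** * Transversals and covers of rectangular matrices *)

Lemma tdet_rows_ge (s t : nat) (A : 'M[nat]_(s, t)) (f : 'I_s -> 'I_t) :
  injective f -> \sum_i A i (f i) <= tdet_rows A.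
Proof.
move=> injf; rewrite (eq_bigr (fun i => A i ([ffun i => f i] i))); last first.
  by move=> i _; rewrite ffunE.
apply: (@leq_bigmax_cond _ _ (fun g : {ffun 'I_s -> 'I_t} => \sum_i A i (g i))).
by apply/injectiveP => i j; rewrite !ffunE; apply: injf.
Qed.

Lemma tdet_rows_le_cover (s t : nat) (A : 'M[nat]_(s, t)) (u : 'I_s -> nat)
    (v : 'I_t -> nat) :
  (forall i j, A i j <= u i + v j) -> tdet_rows A <= \sum_i u i + \sum_j v j.
Proof.
move=> cov; apply/bigmax_leqP => f /injectiveP injf.
apply: (@leq_trans (\sum_i (u i + v (f i)))); first exact: leq_sum.
rewrite big_split leq_add2l /= -(big_imset _ (in2W injf)) /=.
by rewrite [leqRHS](bigID (mem (f @: 'I_s))) leq_addr.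
Qed.

(** Pad [A] with zero rows to a square matrix. The padding adds nothing to an optimal assignment,
    and dropping its part of [u] can only lower the cost of the cover. *)
Lemma egervary_cover (s t : nat) (A : 'M[nat]_(s, t)) : s <= t ->
  exists u v, (forall i j, A i j <= u i + v j) /\
    \sum_i u i + \sum_j v j <= tdet_rows A.
Proof.
move=> le_st; pose w := widen_ord le_st.
pose a (i j : 'I_t) := if insub (i : nat) is Some i' then A i' j else 0.
have aw i j : a (w i) j = A i j by rewrite /a insubT //= => p; congr (A _ j); apply: val_inj.
have [u [v [cov [f injf sumE]]]] := egervary_square a.
exists (fun i => u (w i)), v; split=> [i j|]; first by rewrite -aw.
have wle : \sum_i u (w i) <= \sum_i u i.
  by rewrite -(big_ord_narrow (F := u) le_st) [leqRHS](bigID (fun i : 'I_t => i < s)) leq_addr.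
apply: leq_trans (@tdet_rows_ge _ _ A (fun i => f (w i)) _); last first.
  by move=> i j /injf/(congr1 val) /= /val_inj.
rewrite (leq_trans (leq_add wle (leqnn _))) // sumE.
rewrite (bigID (fun i : 'I_t => i < s)) /= [X in _ + X]big1 ?addn0.
  rewrite (big_ord_narrow le_st) leq_sum // => i _.
  by rewrite -aw.
by move=> i; rewrite /a => ?; rewrite insubN.
Qed.

(** * Lower bound: from covers to feasible pairs *)

Lemma sum_const_ord (n c : nat) : \sum_(i < n) c = n * c.
Proof. by rewrite sum_nat_const card_ord. Qed.

Lemma Smin_le (k l n q r x y : nat) :
  0 < l -> Sfeas k l n q r x y -> Smin k l n q r <= x + y.
Proof.
move=> l0 feas; rewrite /Smin; case: eqP => // h.
case: ex_minnP => s _; apply; rewrite /Spred.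
have hx : x < (x + y).+1 by lia.
have hy : y < (x + y).+1 by lia.
by apply/existsP; exists (Ordinal hx); apply/existsP; exists (Ordinal hy); rewrite eqxx.
Qed.

Lemma SminP (k l n q r : nat) : 0 < l ->
  exists x y, Sfeas k l n q r x y /\ Smin k l n q r = x + y.
Proof.
move=> l0; rewrite /Smin; case: eqP => // h.
case: ex_minnP => s /existsP[x /existsP[y /andP[/eqP e feas]]] _.
by exists x, y.
Qed.

(* Count the entries in the rows with [u i = q]: outside the [y] columns where
   [v] is positive they are at most [q]. *)
Lemma cover_Sfeas (k l n q r : nat) (A : 'M[nat]_(n * k, n * l))
    (u : 'I_(n * k) -> nat) (v : 'I_(n * l) -> nat) (i0 : 'I_(n * k)) (j0 : 'I_(n * l)) :
  inD k l (q * n + r) n A -> (forall i j, A i j <= u i + v j) ->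
  (forall i, q <= u i) -> u i0 = q -> v j0 = 0 ->
  Sfeas k l n q r (\sum_i (u i - q)) (\sum_j v j).
Proof.
move=> [rowA colA] cov qu ui0 vj0.
set X := \sum_i (u i - q); set Y := \sum_j v j.
have geX : r * k <= X.
  have : (q * n + r) * k <= \sum_i u i.
    rewrite -(colA j0); apply: leq_sum => i _; have := cov i j0; lia.
  have -> : \sum_i u i = X + n * k * q.
    rewrite -(sum_const_ord (n * k) q) -big_split /=.
    by apply: eq_bigr => i _; have := qu i; lia.
  nia.
have geY : r * l <= Y.
  have : (q * n + r) * l <= \sum_(j < n * l) (q + v j).
    by rewrite -(rowA i0); apply: leq_sum => j _; have := cov i0 j; lia.
  by rewrite big_split /= sum_const_ord -/Y; nia.
rewrite /Sfeas geX geY !andbT.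
(* The inequality is proved for the support sizes [x <= X] and [y <= Y], and passes to [X] and [Y]
   by monotonicity. *)
pose x := \sum_i (q < u i : nat); pose y := \sum_j (0 < v j : nat).
have lex : x <= X by apply: leq_sum => i _; lia.
have ley : y <= Y by apply: leq_sum => i _; lia.
pose x' := \sum_i (u i <= q : nat); pose y' := \sum_j (v j == 0 : nat).
have ex : x + x' = n * k.
  rewrite -big_split /= -[RHS](card_ord (n * k)) -sum1_card.
  by apply: eq_bigr => i _; lia.
have ey : y + y' = n * l.
  rewrite -big_split /= -[RHS](card_ord (n * l)) -sum1_card.
  by apply: eq_bigr => i _; lia.
have : x' * ((q * n + r) * l) <= q * x' * y' + y * ((q * n + r) * k).
  have -> : x' * ((q * n + r) * l) = \sum_i \sum_j (u i <= q) * A i j.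
    by rewrite big_distrl /=; apply: eq_bigr => i _; rewrite -big_distrr /= rowA.
  have -> : y * ((q * n + r) * k) = \sum_i \sum_j (0 < v j) * A i j.
    rewrite exchange_big big_distrl /=; apply: eq_bigr => j _.
    by rewrite -big_distrr /= colA.
  have -> : q * x' * y' = \sum_i \sum_j q * ((u i <= q) * (v j == 0)).
    rewrite -mulnA big_distrl big_distrr /=; apply: eq_bigr => i _.
    by rewrite big_distrr big_distrr.
  rewrite -big_split /=; apply: leq_sum => i _.
  rewrite -big_split /=; apply: leq_sum => j _.
  have := cov i j; case: (leqP (u i) q) => /= h; last by lia.
  by case: (v j) => [|w] /=; lia.
have step : r * l * x' <= q * x * y + r * k * y ->
    k * l * n * r <= q * X * Y + r * (X * l + Y * k).
  move=> h; have e1 : k * l * n * r = r * l * x + r * l * x' by rewrite -mulnDr ex; lia.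
  have e2 : r * l * x <= r * l * X by rewrite leq_mul.
  have e3 : r * k * y <= r * k * Y by rewrite leq_mul.
  have e4 : q * x * y <= q * X * Y by rewrite !leq_mul.
  lia.
move=> h; apply: step.
(* Once [n * l] and [n * k] are split as [y + y'] and [x + x'], the terms [q * x' * y'] and
   [q * x' * y] cancel. *)
have e1 : x' * ((q * n + r) * l) = q * x' * (y + y') + r * l * x' by rewrite ey; lia.
have e2 : y * ((q * n + r) * k) = q * y * (x + x') + r * k * y by rewrite ex; lia.
by move: h; rewrite e1 e2; lia.
Qed.

Lemma cover_lower_bound (k l n q r : nat) (A : 'M[nat]_(n * k, n * l))
    (u : 'I_(n * k) -> nat) (v : 'I_(n * l) -> nat) :
  0 < k -> k <= l -> 0 < n ->
  inD k l (q * n + r) n A -> (forall i j, A i j <= u i + v j) ->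
  n * k * q + minn (n * k) (Smin k l n q r) <= \sum_i u i + \sum_j v j.
Proof.
move=> k0 kl n0 DA.
have nk0 : 0 < n * k by rewrite muln_gt0 n0.
have nl0 : 0 < n * l by rewrite muln_gt0 n0 (leq_trans k0).
(* Moving the minimum of [v] onto the rows does not raise the cost, because there are at most as
   many rows as columns. *)
suff main (u' : 'I_(n * k) -> nat) (v' : 'I_(n * l) -> nat) j0 :
    (forall i j, A i j <= u' i + v' j) -> v' j0 = 0 ->
    n * k * q + minn (n * k) (Smin k l n q r) <= \sum_i u' i + \sum_j v' j.
  move=> cov; case: (arg_minnP (P := predT) v (i0 := Ordinal nl0)) => // j0 _ minv.
  have cov' i j : A i j <= u i + v j0 + (v j - v j0).
    by have := cov i j; have := minv j isT; lia.
  have := main _ _ j0 cov' (subnn _); rewrite big_split /= sum_const_ord.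
  have <- : \sum_j (v j - v j0) + n * l * v j0 = \sum_j v j.
    rewrite -(sum_const_ord (n * l) (v j0)) -big_split /=.
    by apply: eq_bigr => j _; rewrite subnK //; apply: minv.
  have : n * k * v j0 <= n * l * v j0 by rewrite !leq_mul.
  by move=> h1 h2; apply: leq_trans h2 _; rewrite -addnA leq_add2l addnC leq_add.
move=> {u v}; move: u' v' => u v cov vj0.
have [//|small] := leqP (n * k * q + n * k) (\sum_i u i + \sum_j v j); first by lia.
case: (arg_minnP (P := predT) u (i0 := Ordinal nk0)) => // i0 _ minu.
have uge : n * k * u i0 <= \sum_i u i.
  by rewrite -sum_const_ord leq_sum // => i _; apply: minu.
have vge : (q * n + r) * l <= n * l * u i0 + \sum_j v j.
  rewrite -(DA.1 i0) -(sum_const_ord (n * l) (u i0)) -big_split /=.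
  exact: leq_sum.
(* If the minimum of [u] exceeded [q], then [u] alone would cost at least [n * k * q.+1]. *)
have ule : u i0 <= q.
  rewrite leqNgt; apply/negP => lt.
  have : n * k * q.+1 <= n * k * u i0 by rewrite leq_mul.
  lia.
have uq : u i0 = q.
  (* If it were below [q], row [i0] would force the sum of [v] to be at least [n * l], while column
     [j0] makes the sum of [u] at least [n * k * q]; this is again too much. *)
  apply/eqP; rewrite eqn_leq ule /= leqNgt; apply/negP => lt.
  have h1 : n * l * (u i0).+1 <= n * l * q by rewrite leq_mul.
  have h2 : (q * n + r) * k <= \sum_i u i.
    rewrite -(DA.2 j0); apply: leq_sum => i _; have := cov i j0; lia.
  have h3 : n * k <= n * l by rewrite leq_mul.
  lia.
have qu i : q <= u i by rewrite -uq; apply: minu.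
have := Smin_le (leq_trans k0 kl) (cover_Sfeas DA cov qu uq vj0).
have -> : \sum_i u i = \sum_i (u i - q) + n * k * q.
  rewrite -(sum_const_ord (n * k) q) -big_split /=.
  by apply: eq_bigr => i _; have := qu i; lia.
lia.
Qed.

(** * Residue counting and the evenly filled hook *)

Lemma sum_delta_nat (N z : nat) : z < N -> \sum_(0 <= j < N) (z == j : nat) = 1.
Proof.
move=> lt; rewrite big_mkord (bigD1 (Ordinal lt)) //= eqxx big1 // => i /eqP ne.
by case: eqP => // e; case: ne; apply: val_inj.
Qed.

Lemma count_residue_window (p s j : nat) : j < p ->
  \sum_(s <= t < s + p) (t %% p == j : nat) = 1.
Proof.
move=> jp; elim: s => [|s IH].
  rewrite add0n -(sum_delta_nat jp) big_nat [RHS]big_nat.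
  by apply: eq_bigr => t /andP[_ tp]; rewrite modn_small // eq_sym.
rewrite addSn big_nat_recr /=; last by lia.
rewrite modnDr addnC -IH [RHS]big_ltn //; lia.
Qed.

Lemma count_residue_window_le1 (p s a j : nat) : j < p -> a <= p ->
  \sum_(s <= t < s + a) (t %% p == j : nat) <= 1.
Proof.
move=> jp ap; rewrite -(count_residue_window s jp).
by rewrite [leqRHS](big_cat_nat (n := s + a)) ?leq_addr ?leq_add2l.
Qed.

Lemma sum_consecutive_windows (F : nat -> nat) (s a c : nat) :
  \sum_(0 <= b < c) \sum_(s + b * a <= t < s + b * a + a) F t =
  \sum_(s <= t < s + c * a) F t.
Proof.
elim: c => [|c IH]; first by rewrite mul0n addn0 !big_geq.
rewrite big_nat_recr //= IH mulSn [a + _]addnC addnA.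
by rewrite [in RHS](big_cat_nat (n := s + c * a)) ?leq_addr.
Qed.

(** The shift is constant on each block of [p] consecutive [t], so each block is still a full
    residue system. *)
Lemma count_shifted_residue (p c j : nat) (h : nat -> nat) : j < p ->
  \sum_(0 <= t < p * c) ((t + h (t %/ p)) %% p == j : nat) = c.
Proof.
move=> jp.
have := sum_consecutive_windows (fun t => ((t + h (t %/ p)) %% p == j) : nat) 0 p c.
rewrite add0n mulnC => <-.
rewrite (eq_bigr (fun=> 1)) ?sum_nat_const_nat ?subn0 ?muln1 // => b _.
rewrite add0n -(count_residue_window (b * p + h b) jp) addnAC big_addn addnK.
rewrite big_nat [RHS]big_nat; apply: eq_bigr => t lt.
suff -> : t %/ p = b by [].
have p0 : 0 < p by lia.
by rewrite -(subnKC (proj1 (andP lt))) divnMDl // divn_small ?addn0 //; lia.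
Qed.

Lemma count_injective_le1 (P : pred nat) (a b : nat) :
  (forall s t, a <= s < b -> a <= t < b -> P s -> P t -> s = t) ->
  \sum_(a <= t < b) (P t : nat) <= 1.
Proof.
move=> inj; have [/hasP[s]|/hasPn nP] := boolP (has P (index_iota a b)).
  rewrite mem_index_iota => ls Ps.
  rewrite (bigD1_seq s) ?mem_index_iota ?iota_uniq //= Ps big_nat_cond big1 // => t.
  by move=> /andP[lt ne]; case: (boolP (P t)) => // Pt; rewrite (inj t s) ?eqxx in ne.
by rewrite big_nat big1 // => t lt; rewrite (negbTE (nP t _)) ?mem_index_iota.
Qed.

(* Modulo [d = gcd x y] the two congruences determine [t %/ lcm], because a window
   of length [x * y] meets [d] consecutive blocks of length [lcm]. *)
Lemma diagonal_walk_inj (x y w s t : nat) : 0 < x -> 0 < y ->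
  w * (x * y) <= s < w.+1 * (x * y) -> w * (x * y) <= t < w.+1 * (x * y) ->
  s = t %[mod x] -> s + s %/ lcmn x y = t + t %/ lcmn x y %[mod y] -> s = t.
Proof.
move=> x0 y0 ws wt ex ey; set L := lcmn x y in ey; set d := gcdn x y.
have L0 : 0 < L by rewrite lcmn_gt0 x0.
have Ld : x * y = d * L by rewrite [d * L]mulnC muln_lcm_gcd.
have dx : d %| x by apply: dvdn_gcdl.
have dy : d %| y by apply: dvdn_gcdr.
have ed : s = t %[mod d] by rewrite -(modn_dvdm s dx) ex modn_dvdm.
have efd : s %/ L = t %/ L %[mod d].
  have : s + s %/ L = t + t %/ L %[mod d] by rewrite -(modn_dvdm (s + _) dy) ey modn_dvdm.
  by rewrite -modnDml ed modnDml => /eqP; rewrite eqn_modDl => /eqP.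
have bl z : w * (x * y) <= z < w.+1 * (x * y) -> w * d <= z %/ L < w.+1 * d.
  by rewrite Ld !mulnA leq_divRL // ltn_divLR.
have ef : s %/ L = t %/ L.
  have d0 : 0 < d by rewrite gcdn_gt0 x0.
  have fd z : w * d <= z < w.+1 * d -> z %/ d = w.
    by move=> b; apply/eqP; rewrite eqn_leq -ltnS ltn_divLR // leq_divRL // andbC.
  by rewrite (divn_eq (s %/ L) d) (divn_eq (t %/ L) d) efd (fd _ (bl s ws)) (fd _ (bl t wt)).
(* Equal quotients cancel from the second congruence, so [s] and [t] agree modulo [y] as well, hence
   modulo [L]. *)
move: ey; rewrite ef => /eqP; rewrite eqn_modDr => ey.
have eL : s = t %[mod L].
  apply/eqP; wlog le_st : s t {ws wt ed efd ef} ex ey / s <= t.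
    by move=> H; case/orP: (leq_total s t) => le; [|rewrite eq_sym]; apply: H => //; rewrite eq_sym.
  rewrite eq_sym eqn_mod_dvd // dvdn_lcm -!eqn_mod_dvd // [X in _ && X]eq_sym ey andbT.
  by apply/eqP.
by rewrite (divn_eq s L) ef eL -divn_eq.
Qed.

Lemma sum_residue_classes (F : nat -> nat) (s s' p : nat) (P : pred nat) :
  (forall t, s <= t < s' -> F t < p) ->
  \sum_(0 <= j < p) \sum_(s <= t < s') (P t && (F t == j) : nat) =
  \sum_(s <= t < s') (P t : nat).
Proof.
move=> ltF; rewrite exchange_big /= big_nat [RHS]big_nat; apply: eq_bigr => t lt.
case: (P t) => /=; last by rewrite big1.
exact: sum_delta_nat (ltF t lt).
Qed.

Lemma sum_nat_shift_split (F : nat -> nat) (p N : nat) : p <= N ->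
  \sum_(0 <= j < N) F j = \sum_(0 <= j < p) F j + \sum_(0 <= j < N - p) F (j + p).
Proof.
by move=> pN; rewrite (big_cat_nat (n := p)) //= -[X in _ + \sum_(X <= _ < _) _]add0n big_addn.
Qed.

(* A single counter [t] fills the cells cyclically: the corner [x * y] takes the first
   [W] values, and the two off-diagonal blocks both continue from [W], so each row of
   the first and each column of the second is hit equally often.  The column index
   advances by one extra step every [lcmn x y] values of [t < W], which spreads the
   corner entries evenly. *)
Lemma hook_matrix (P Q q a b x y W : nat) :
  0 < x -> 0 < y -> x <= P -> y <= Q -> a <= x -> b <= y ->
  W + (Q - y) * a = x * (q * y + b) -> W + (P - x) * b = y * (q * x + a) ->
  W <= q.+2 * (x * y) ->
  exists F : nat -> nat -> nat,
    [/\ forall i, i < P -> \sum_(0 <= j < Q) F i j = q * Q + b,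
        forall j, j < Q -> \sum_(0 <= i < P) F i j = q * P + a &
        forall i j, F i j <= q + (i < x) + (j < y)].
Proof.
move=> x0 y0 xP yQ ax yb eR eC leW.
pose e := lcmn x y %/ y.
have ye : y * e = lcmn x y by rewrite mulnC divnK // dvdn_lcmr.
(* As a function of [t %/ y], the shift keeps columns equidistributed. Below [W] it equals
   [t %/ lcmn x y]; the cap freezes it from [W] on, so that [b <= y] successive values of [t] hit
   distinct columns. *)
pose h c := minn c (W %/ y) %/ e.
pose g t := (t + h (t %/ y)) %% y.
have gy t : g t < y by rewrite ltn_mod.
have g_small t : t < W -> g t = (t + t %/ lcmn x y) %% y.
  move=> tW; rewrite /g /h (minn_idPl _) ?leq_div2r ?(ltnW tW) //.
  by rewrite -divnMA ye.
have g_large t : W <= t -> g t = (t + h (W %/ y)) %% y.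
  by move=> tW; rewrite /g /h minnn (minn_idPr _) ?leq_div2r.
pose corner i j := \sum_(0 <= t < W) ((t %% x == i) && (g t == j) : nat).
pose tr i j := \sum_(W + j * a <= t < W + j * a + a) (t %% x == i : nat).
pose bl i j := \sum_(W + i * b <= t < W + i * b + b) (g t == j : nat).
have corner_le i j : corner i j <= q.+2.
  (* The range [t < W] lies in [q.+2] windows of length [x * y], and each window visits a cell at
     most once. *)
  have split : corner i j <= \sum_(0 <= w < q.+2)
      \sum_(0 + w * (x * y) <= t < 0 + w * (x * y) + x * y)
         ((t %% x == i) && ((t + t %/ lcmn x y) %% y == j) : nat).
    rewrite sum_consecutive_windows add0n [leqRHS](big_cat_nat (n := W)) //=.
    apply: leq_trans (leq_addr _ _).
    rewrite /corner big_nat [leqRHS]big_nat leq_sum // => t /andP[_ tW].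
    by rewrite g_small.
  apply: leq_trans split _; rewrite -[leqRHS]muln1 -[q.+2 in leqRHS]subn0.
  rewrite -sum_nat_const_nat leq_sum // => w _; apply: count_injective_le1.
  move=> s t; rewrite !add0n -mulSnr => ws wt /andP[/eqP s1 /eqP s2] /andP[/eqP t1 /eqP t2].
  by apply: (diagonal_walk_inj x0 y0 ws wt); rewrite ?s1 ?s2.
have tr_le i j : i < x -> tr i j <= 1 by move=> ix; apply: count_residue_window_le1.
have bl_le i j : j < y -> bl i j <= 1.
  move=> jy; have := count_residue_window_le1 (W + i * b + h (W %/ y)) jy yb.
  rewrite (addnAC (W + i * b)) big_addn addnK; apply: leq_trans.
  rewrite /bl big_nat [leqRHS]big_nat leq_sum // => t /andP[tW _].
  by rewrite g_large // (leq_trans _ tW) // leq_addr.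
have tr_col j : \sum_(0 <= i < x) tr i j = a.
  rewrite (sum_residue_classes (F := fun t => t %% x) predT) => [|t _].
    by rewrite sum_nat_const_nat muln1 addKn.
  by rewrite ltn_mod.
have bl_row i : \sum_(0 <= j < y) bl i j = b.
  rewrite (sum_residue_classes (F := g) predT) //.
  by rewrite sum_nat_const_nat muln1 addKn.
(* The corner range and the windows of [tr] tile an initial interval of length [x * (q * y + b)], by
   [eR]. The same holds for columns with [bl] and [eC]. *)
have row_top i : i < x ->
    \sum_(0 <= j < y) corner i j + \sum_(0 <= j < Q - y) tr i j = q * y + b.
  move=> ix; rewrite (sum_residue_classes (F := g) (fun t => t %% x == i)) //.
  rewrite sum_consecutive_windows -big_cat_nat ?leq_addr //= eR.
  rewrite -[RHS](count_shifted_residue _ (fun=> 0) ix); apply: eq_bigr => t _.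
  by rewrite addn0.
have col_left j : j < y ->
    \sum_(0 <= i < x) corner i j + \sum_(0 <= i < P - x) bl i j = q * x + a.
  move=> jy; rewrite (eq_bigr (fun i => \sum_(0 <= t < W)
      ((g t == j) && (t %% x == i) : nat))); last first.
    by move=> i _; apply: eq_bigr => t _; rewrite andbC.
  rewrite (sum_residue_classes (F := fun t => t %% x) (fun t => g t == j)).
    rewrite sum_consecutive_windows -big_cat_nat ?leq_addr //= eC.
    exact: count_shifted_residue.
  by move=> t _; rewrite ltn_mod.
exists (fun i j => if i < x then if j < y then corner i j else q + tr i (j - y)
                   else if j < y then q + bl (i - x) j else q).
split=> [i iP|j jQ|i j].
- rewrite (sum_nat_shift_split _ yQ).
  have [ix|xi] := ltnP i x.
    rewrite (eq_big_nat _ _ (F2 := corner i)) => [|j /andP[_ ->] //].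
    rewrite [X in _ + X](eq_bigr (fun j => q + tr i j)) => [|j _].
      by rewrite big_split /= sum_nat_const_nat addnCA row_top //; nia.
    by rewrite ltnNge leq_addl addnK.
  rewrite (eq_big_nat _ _ (F2 := fun j => q + bl (i - x) j)) => [|j /andP[_ ->] //].
  rewrite [X in _ + X](eq_bigr (fun=> q)) => [|j _].
    by rewrite big_split /= !sum_nat_const_nat bl_row; nia.
  by rewrite ltnNge leq_addl.
- rewrite (sum_nat_shift_split _ xP).
  have [jy|yj] := ltnP j y.
    rewrite (eq_big_nat _ _ (F2 := fun i => corner i j)) => [|i /andP[_ ->] //].
    rewrite [X in _ + X](eq_bigr (fun i => q + bl i j)) => [|i _].
      by rewrite big_split /= sum_nat_const_nat addnCA col_left //; nia.
    by rewrite ltnNge leq_addl addnK.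
  rewrite (eq_big_nat _ _ (F2 := fun i => q + tr i (j - y))) => [|i /andP[_ ->] //].
  rewrite [X in _ + X](eq_bigr (fun=> q)) => [|i _].
    by rewrite big_split /= !sum_nat_const_nat tr_col; nia.
  by rewrite ltnNge leq_addl.
- case: (ltnP i x) => ix; case: (ltnP j y) => jy //=.
  + by rewrite !addn1.
  + by rewrite addn0 leq_add2l tr_le.
  + by rewrite addn0 leq_add2l bl_le.
  + by rewrite !addn0.
Qed.

Lemma circulant_row_sum (n r c i : nat) : r <= n ->
  \sum_(0 <= j < n * c) ((j + i) %% n < r : nat) = r * c.
Proof.
move=> rn; rewrite (eq_bigr (fun j => \sum_(0 <= d < r) ((j + i) %% n == d : nat))).
  rewrite exchange_big /= (eq_big_nat _ _ (F2 := fun=> c)) => [|d /andP[_ dr]].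
    by rewrite sum_nat_const_nat subn0.
  exact: count_shifted_residue (fun=> i) (leq_trans dr rn).
move=> j _; case: ltnP => lt; first by rewrite sum_delta_nat.
by rewrite big_nat big1 // => d /andP[_ dr]; case: eqP lt => // ->; rewrite leqNgt dr.
Qed.

(** * Matrices attaining the bound *)

Lemma matrix_of_cover (k l n m : nat) (F : nat -> nat -> nat) (u v : nat -> nat) :
  k <= l ->
  (forall i, i < n * k -> \sum_(0 <= j < n * l) F i j = m * l) ->
  (forall j, j < n * l -> \sum_(0 <= i < n * k) F i j = m * k) ->
  (forall i j, F i j <= u i + v j) ->
  exists A : 'M[nat]_(n * k, n * l), inD k l m n A /\
    tdet A <= \sum_(0 <= i < n * k) u i + \sum_(0 <= j < n * l) v j.
Proof.
move=> kl rowF colF cov; exists (\matrix_(i, j) F i j)%R; split.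
  split=> [i|j]; rewrite -?(rowF i) -?(colF j) // big_mkord.
    by apply: eq_bigr => j _; rewrite mxE.
  by apply: eq_bigr => i _; rewrite mxE.
rewrite /tdet leq_mul2l kl orbT !big_mkord.
by apply: tdet_rows_le_cover => i j; rewrite mxE.
Qed.

Lemma small_tdet_exists (k l n q r : nat) :
  0 < k -> k <= l -> 0 < n -> r < n ->
  exists A : 'M[nat]_(n * k, n * l), inD k l (q * n + r) n A /\
    tdet A <= n * k * q + minn (n * k) (Smin k l n q r).
Proof.
move=> k0 kl n0 rn; have l0 := leq_trans k0 kl.
have nkl : n * k <= n * l by rewrite leq_mul.
have [x [y [/and3P[feas xr yr] SE]]] := SminP k n q r l0.
(* Positive [r] makes [x] and [y] positive, as the hook requires. For [r = 0] the circulant is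
   constant [q], and its cover costs only [n * k * q]. *)
have [/andP[r0 Ssmall]|big] := boolP ((0 < r) && (x + y < n * k)).
  pose W := q * x * y + r * (x * l + y * k) - k * l * n * r.
  have x0 : 0 < x by apply: leq_trans xr; rewrite muln_gt0 r0.
  have y0 : 0 < y by apply: leq_trans yr; rewrite muln_gt0 r0.
  have xP : x <= n * k by lia.
  have yQ : y <= n * l by lia.
  have eR : W + (n * l - y) * (r * k) = x * (q * y + r * l).
    have h : y * (r * k) <= n * l * (r * k) by rewrite leq_mul.
    by rewrite mulnBl /W; lia.
  have eC : W + (n * k - x) * (r * l) = y * (q * x + r * k).
    have h : x * (r * l) <= n * k * (r * l) by rewrite leq_mul.
    by rewrite mulnBl /W; lia.
  (* The bounds [r * l <= y] and [r * k <= x] each contribute one extra [x * y] to [q * x * y]. *)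
  have leW : W <= q.+2 * (x * y).
    have h1 : x * (r * l) <= x * y by rewrite leq_mul.
    have h2 : y * (r * k) <= y * x by rewrite leq_mul.
    rewrite /W; lia.
  have [F [rowF colF covF]] := hook_matrix x0 y0 xP yQ xr yr eR eC leW.
  have [|||A [DA tA]] := @matrix_of_cover k l n (q * n + r) F
      (fun i => q + (i < x)) (fun j => (j < y) : nat) kl.
  - by move=> i iP; rewrite rowF //; lia.
  - by move=> j jQ; rewrite colF //; lia.
  - by [].
  exists A; split=> //; apply: leq_trans tA _.
  have count z N : z <= N -> \sum_(0 <= i < N) (i < z : nat) = z.
    move=> zN; rewrite (big_cat_nat (n := z)) //=.
    rewrite (eq_big_nat _ _ (F2 := fun=> 1)) => [|i /andP[_ ->] //].
    rewrite [X in _ + X](eq_big_nat _ _ (F2 := fun=> 0)) => [|i /andP[zi _]].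
      by rewrite !sum_nat_const_nat muln1 muln0 subn0 addn0.
    by rewrite ltnNge zi.
  rewrite big_split /= !count // sum_nat_const_nat SE; lia.
have [|||A [DA tA]] := @matrix_of_cover k l n (q * n + r)
    (fun i j => q + ((i + j) %% n < r)) (fun=> q + (0 < r)) (fun=> 0) kl.
- move=> i _; rewrite big_split /= sum_nat_const_nat.
  rewrite [X in _ + X](eq_bigr (fun j => (j + i) %% n < r : nat)) => [|j _].
    by rewrite circulant_row_sum ?(ltnW rn) //; lia.
  by rewrite addnC.
- move=> j _; rewrite big_split /= sum_nat_const_nat.
  by rewrite circulant_row_sum ?(ltnW rn) //; lia.
- by move=> i j; case: ltnP => h; lia.
exists A; split=> //; apply: leq_trans tA _.
rewrite !sum_nat_const_nat SE; case: (posnP r) big => [_ _|_]; first by rewrite /=; lia.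
by rewrite /= -leqNgt => h; rewrite muln0 addn0 (minn_idPl h); lia.
Qed.

Theorem theorem3p4 (k l n m q r : nat) :
  0 < k -> k <= l -> coprime k l -> 0 < n ->
  m = q * n + r -> r < n ->
  (exists A : 'M[nat]_(n * k, n * l),
      inD k l m n A /\ tdet A = n * k * q + minn (n * k) (Smin k l n q r)) /\
  (forall A : 'M[nat]_(n * k, n * l),
      inD k l m n A -> n * k * q + minn (n * k) (Smin k l n q r) <= tdet A).
Proof.
move=> k0 kl _ n0 -> rn.
have lower (A : 'M[nat]_(n * k, n * l)) : inD k l (q * n + r) n A ->
    n * k * q + minn (n * k) (Smin k l n q r) <= tdet A.
  move=> DA; have nkl : n * k <= n * l by rewrite leq_mul.
  have [u [v [cov le]]] := egervary_cover A nkl.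
  rewrite /tdet nkl; apply: leq_trans le.
  exact: cover_lower_bound k0 kl n0 DA cov.
split=> //; have [A [DA tA]] := small_tdet_exists q k0 kl n0 rn.
by exists A; split=> //; apply/eqP; rewrite eqn_leq tA lower.
Qed.
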